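(* Let $G=(V,E)$ be a $D$-regular graph of diameter $L$ and let $e=\{x,y\}\in E$. Assume that $e$ is contained in precisely $\frac{2D}{L}-2$ triangles and that there is a perfect matching (consisting of edges of $G$) between the neighbours of $x$ and the neighbours of $y$ which are not involved in these triangles, that is, between the vertex sets $N_x\setminus(N_{xy}\cup\{y\})$ and $N_y\setminus(N_{xy}\cup\{x\})$. Then $$\kappa(x,y)=\frac{2}{L}.$$
   Context: All graphs are finite, simple, undirected, unweighted, connected, and have at least one edge. $d$ denotes the combinatorial (shortest path) distance, $N_x$ is the set of neighbours of $x$, and $N_{xy}=N_x\cap N_y$. For a $D$-regular graph $G=(V,E)$ and $x\in V$, let $\mu_x$ be the probability measure on $V$ giving mass $\frac1{D+1}$ to $x$ and to each of its $D$ neighbours. The Wasserstein distance of probability measures $\mu,\nu$ on $V$ is $W_1(\mu,\nu)=\inf_\pi\sum_{u,v\in V}d(u,v)\pi(u,v)$, where $\pi:V\times V\to[0,1]$ runs over all couplings with marginals $\mu(u)=\sum_v\pi(u,v)$ and $\nu(v)=\sum_u\pi(u,v)$. The (modified) Ollivier Ricci curvature of two different vertices $x,y$ is $$\kappa(x,y)=\frac{D+1}{D}\left(1-\frac{W_1(\mu_x,\mu_y)}{d(x,y)}\right).$$ *)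

(* Defs.v *)
From HB Require Import structures.
From mathcomp Require Import all_boot all_order all_algebra.
From mathcomp Require Import boolp classical_sets reals.
Set Implicit Arguments.
Unset Strict Implicit.
Unset Printing Implicit Defensive.
Import Order.TTheory GRing.Theory Num.Theory.
Local Open Scope ring_scope.

Section Graphs.
Variables (V : finType) (e : rel V).

Definition simple_graph : Prop := symmetric e /\ irreflexive e.

Definition connected_graph : Prop := forall u v : V, connect e u v.

Definition nbh (u : V) : {set V} := [set v | e u v]%SET.

Definition regular (D : nat) : Prop := forall u : V, #|nbh u| = D.

Definition edges : {set {set V}} := [set [set u; v] | u in V, v in nbh u]%SET.

Definition triangles : {set {set V}} :=
  [set T : {set V} | (#|T| == 3)
     && [forall u in T, forall v in T, (u != v) ==> e u v]]%SET.

Definition walk_of_length (n : nat) (u v : V) : bool :=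
  [exists p : n.-tuple V, path e u p && (last u p == v)].

(* A shortest walk has length < #|V|, so the search may be bounded;
   the default value #|V| is only taken when v is not reachable from u. *)
Definition gdist (u v : V) : nat :=
  \big[minn/#|V|]_(n < #|V| | walk_of_length n u v) n.

Definition diameter : nat := \max_(u : V) \max_(v : V) gdist u v.

(* Perfect matching, by edges of the graph, between disjoint A and B. *)
Definition perfect_matching (A B : {set V}) (M : {set {set V}}) : Prop :=
  [/\ M \subset edges,
      forall f : {set V}, f \in M ->
        exists a b : V, [/\ a \in A, b \in B & f = [set a; b]%SET]
    & finset.partition M (A :|: B)%SET].

End Graphs.

Section Curvature.
Variables (R : realType) (V : finType) (e : rel V).

Definition mu (D : nat) (x : V) : V -> R :=
  fun u => if (u == x) || e x u then D.+1%:R^-1 else 0.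

Definition coupling (m1 m2 : V -> R) (pi : V -> V -> R) : Prop :=
  [/\ forall u v, 0 <= pi u v <= 1,
      forall u, m1 u = \sum_(v : V) pi u v
    & forall v, m2 v = \sum_(u : V) pi u v].

Definition transport_cost (pi : V -> V -> R) : R :=
  \sum_(u : V) \sum_(v : V) (gdist e u v)%:R * pi u v.

Definition W1 (m1 m2 : V -> R) : R :=
  inf [set transport_cost pi | pi in [set pi | coupling m1 m2 pi]]%classic.

Definition kappa (D : nat) (x y : V) : R :=
  D.+1%:R / D%:R * (1 - W1 (mu D x) (mu D y) / (gdist e x y)%:R).

End Curvature.

(* Main.v *)
Require Import Defs.
From HB Require Import structures.
From mathcomp Require Import all_boot all_order all_algebra.
From mathcomp Require Import boolp classical_sets reals.
From mathcomp Require Import fintype finset.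
Set Implicit Arguments.
Unset Strict Implicit.
Unset Printing Implicit Defensive.
Import Order.TTheory GRing.Theory Num.Theory.
Local Open Scope ring_scope.

(** Write [t] for the number of common neighbours of [x] and [y], which is also
    the number of triangles on the edge [{x, y}].  The measures [mu_x] and
    [mu_y] both give mass [1/(D+1)] to [x], [y] and the common neighbours, so
    they differ only on the [D - 1 - t] private neighbours of [x] and the
    equally many private neighbours of [y].

    - The mass [(D-1-t)/(D+1)] on the private neighbours of [x] lies outside the
      support of [mu_y], hence every coupling moves it by at least one step
      ([sum_le_transport_cost]).
    - The perfect matching attains this bound: leave the common mass in place
      and push each private neighbour of [x] along its matching edge
      ([matching_plan_coupling], [matching_plan_cost]).

    Thus [W1 = (D-1-t)/(D+1)] ([W1_matching]).  As [d(x,y) = 1], the curvature is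
    [(t+2)/D], and the hypothesis [t = 2D/L - 2] turns this into [2/L]. *)

(** * Graph distance *)

Section Distance.
Variables (V : finType) (e : rel V).

Lemma gdist_le_size (u : V) (p : seq V) :
  path e u p -> (size p < #|V|)%N -> (gdist e u (last u p) <= size p)%N.
Proof.
move=> up ltp; rewrite /gdist.
have wp : walk_of_length e (Ordinal ltp) u (last u p).
  by apply/existsP; exists (in_tuple p); rewrite up eqxx.
exact: (@bigmin_le_cond _ nat _ _ (Ordinal ltp)).
Qed.

Lemma gdist_refl (u : V) : gdist e u u = 0%N.
Proof.
apply/eqP; rewrite -leqn0; apply: (@gdist_le_size u [::]) => //=.
by apply/card_gt0P; exists u.
Qed.

Lemma gdist_gt0 (u v : V) : u != v -> (0 < gdist e u v)%N.
Proof.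
move=> uv; rewrite /gdist; elim/big_ind: _ => [|m n m0 n0|n].
- by apply/card_gt0P; exists u.
- by rewrite leq_min m0.
- case: n => -[|n] //= ltn /existsP[p /andP[_]].
  by rewrite (tuple0 p) /= (negPf uv).
Qed.

Lemma gdist_edge (u v : V) : irreflexive e -> e u v -> gdist e u v = 1%N.
Proof.
move=> irr uv; have neq : u != v by apply: contraTneq uv => ->; rewrite irr.
apply/eqP; rewrite eqn_leq gdist_gt0 // andbT.
apply: (@gdist_le_size u [:: v]); rewrite /= ?uv //.
by rewrite (cardD1 u) (cardD1 v) !inE eq_sym neq.
Qed.

End Distance.

(** * Triangles and perfect matchings *)

Section Combinatorics.
Variables (V : finType) (e : rel V).
Hypotheses (sym_e : symmetric e) (irr_e : irreflexive e).

Lemma edge_neq (u v : V) : e u v -> u != v.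
Proof. by move=> uv; apply: contraTneq uv => ->; rewrite irr_e. Qed.

(** A triangle on the edge [{x, y}] is determined by its apex, which is a common
    neighbour of [x] and [y]. *)
Lemma card_triangles_edge (x y : V) : e x y ->
  #|[set T in triangles e | [set x; y] \subset T]%SET|
    = #|nbh e x :&: nbh e y|%SET.
Proof.
move=> exy; have xy := edge_neq exy.
have -> : [set T in triangles e | [set x; y] \subset T]%SET
    = [set z |: [set x; y] | z in nbh e x :&: nbh e y]%SET.
  apply/setP => T; rewrite !inE; apply/idP/imsetP.
  - case/andP=> /andP[/eqP T3 /forall_inP Tcl] xyT.
    have /cards1P[z Tz] : #|T :\: [set x; y]|%SET == 1%N.
      by rewrite cardsD (setIidPr xyT) T3 cards2 xy.
    have /setDP[zT zxy] : z \in (T :\: [set x; y])%SET by rewrite Tz set11.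
    exists z; last first.
      by rewrite -Tz setUC -{1}(setIidPr xyT) setID.
    move: zxy; rewrite !inE negb_or => /andP[zx zy].
    have [xT yT] : x \in T /\ y \in T.
      by split; apply: (subsetP xyT); rewrite !inE eqxx ?orbT.
    have adj u : u \in T -> z != u -> e u z.
      move=> uT zu; have /forall_inP/(_ z zT) := Tcl u uT.
      by rewrite eq_sym zu.
    by rewrite !adj.
  - case=> z; rewrite !inE => /andP[xz yz] ->.
    rewrite subsetUr andbT cardsU1 cards2 xy !inE negb_or.
    rewrite ![z == _]eq_sym !edge_neq //=.
    apply/forall_inP => u; rewrite !inE => hu.
    apply/forall_inP => v; rewrite !inE => hv.
    apply/implyP => uv; move: hu hv uv.
    by case/or3P=> /eqP->; case/or3P=> /eqP->; rewrite ?eqxx // 1?sym_e.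
rewrite card_in_imset // => z w; rewrite !inE => /andP[xz yz] /andP[xw yw] zw.
have: z \in (w |: [set x; y])%SET by rewrite -zw setU11.
by rewrite !inE ![z == _]eq_sym (negPf (edge_neq xz)) (negPf (edge_neq yz))
  !orbF => /eqP.
Qed.

Lemma perfect_matchingC (A B : {set V}) (M : {set {set V}}) :
  perfect_matching e A B M -> perfect_matching e B A M.
Proof.
case=> sM M2 pM; split=> //; last by rewrite setUC.
by move=> f /M2[a [b [aA bB ->]]]; exists b, a; rewrite setUC.
Qed.

Lemma edges_adj (a b : V) : a != b -> [set a; b]%SET \in edges e -> e a b.
Proof.
move=> ab /imset2P[u v _]; rewrite inE => uv abE.
have : a \in [set u; v]%SET by rewrite -abE set21.
have : b \in [set u; v]%SET by rewrite -abE set22.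
rewrite !inE => /orP[]/eqP bE /orP[]/eqP aE; move: ab; rewrite aE bE ?eqxx //.
by rewrite sym_e.
Qed.

(** The blocks of a partition cover every vertex exactly once, so a vertex of
    [A] lies in exactly one matching edge. *)
Lemma matching_partner (A B : {set V}) (M : {set {set V}}) (a : V) :
  [disjoint A & B] -> perfect_matching e A B M -> a \in A ->
  exists b, forall v, (v \in B) && ([set a; v]%SET \in M) = (v == b).
Proof.
move=> dAB [_ M2 /and3P[/eqP covM trivM _]] aA.
have : a \in cover M by rewrite covM inE aA.
case/bigcupP=> f fM af; have [a' [b [a'A bB fE]]] := M2 f fM.
have fab : f = [set a; b]%SET.
  move: af; rewrite fE !inE => /orP[/eqP-> //|/eqP ab].
  by move: (disjointFr dAB aA); rewrite ab bB.
exists b => v; apply/idP/eqP => [/andP[vB avM]|->]; last by rewrite bB -fab.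
have vf : v \in f.
  have -> : f = [set a; v]%SET.
    by rewrite -(def_pblock trivM fM af) (def_pblock trivM avM) ?set21.
  exact: set22.
move: vf; rewrite fab !inE => /orP[/eqP va|/eqP //].
by move: (disjointFr dAB aA); rewrite -va vB.
Qed.

End Combinatorics.

(** * Transport costs *)

Section Transport.
Variables (R : realType) (V : finType) (e : rel V).

(** Mass sitting where the target measure vanishes cannot stay in place, and
    moving it costs at least one unit of distance. *)
Lemma sum_le_transport_cost (m1 m2 : V -> R) (pi : V -> V -> R) (S : {set V}) :
  coupling m1 m2 pi -> {in S, forall u, m2 u = 0} ->
  \sum_(u in S) m1 u <= transport_cost e pi.
Proof.
case=> pi01 row col m2S.
have pi0 u v : 0 <= pi u v by case/andP: (pi01 u v).
rewrite /transport_cost big_mkcond; apply: ler_sum => u _.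
case: ifP => uS; last by apply: sumr_ge0 => v _; rewrite mulr_ge0.
rewrite row; apply: ler_sum => v _.
have [<-|uv] := eqVneq u v; last by rewrite ler_peMl // ler1n gdist_gt0.
suff -> : pi u u = 0 by rewrite mulr0.
have /esym/eqP := col u; rewrite m2S // psumr_eq0 // => /allP/(_ u).
by rewrite mem_index_enum => /(_ isT)/eqP.
Qed.

Lemma sum_if_pred1 (c : R) (P : pred V) (w : V) :
  P =1 pred1 w -> \sum_(v : V) (if P v then c else 0) = c.
Proof. by move=> Pw; rewrite -big_mkcond (big_pred1 w). Qed.

Lemma W1_eq_cost (m1 m2 : V -> R) (pi : V -> V -> R) :
  coupling m1 m2 pi ->
  (forall pi', coupling m1 m2 pi' ->
     transport_cost e pi <= transport_cost e pi') ->
  W1 e m1 m2 = transport_cost e pi.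
Proof.
move=> cpi min_pi; apply/eqP; rewrite eq_le /W1; apply/andP; split.
- apply: ge_inf; last by exists pi.
  by exists (transport_cost e pi) => _ [pi' cpi' <-]; apply: min_pi.
- apply: lb_le_inf; first by exists (transport_cost e pi), pi.
  by move=> _ [pi' cpi' <-]; apply: min_pi.
Qed.

End Transport.

(** * The optimal plan given by a matching *)

Section MatchingPlan.
Variables (R : realType) (V : finType) (e : rel V).
Hypotheses (sym_e : symmetric e) (irr_e : irreflexive e).
Variables (A B C : {set V}) (M : {set {set V}}).
Hypotheses (dAB : [disjoint A & B]) (dAC : [disjoint A & C]).
Hypotheses (dBC : [disjoint B & C]) (match_M : perfect_matching e A B M).

Definition matching_rel (u v : V) : bool :=
  ((u \in C) && (v == u)) ||
  [&& u \in A, v \in B & [set u; v]%SET \in M].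

Definition matching_plan (c : R) (u v : V) : R :=
  if matching_rel u v then c else 0.

Lemma matching_plan_row (c : R) (u : V) :
  \sum_v matching_plan c u v = if u \in (A :|: C)%SET then c else 0.
Proof.
rewrite /matching_plan inE /matching_rel.
have [uA|uA] /= := boolP (u \in A).
  have [b bP] := matching_partner dAB match_M uA.
  by apply: (@sum_if_pred1 _ _ _ _ b) => v; rewrite (disjointFr dAC uA) bP.
have [uC|uC] /= := boolP (u \in C); last by rewrite big1.
by apply: (@sum_if_pred1 _ _ _ _ u) => v; rewrite orbF.
Qed.

Lemma matching_plan_col (c : R) (v : V) :
  \sum_u matching_plan c u v = if v \in (B :|: C)%SET then c else 0.
Proof.
rewrite /matching_plan inE /matching_rel.
have dBA : [disjoint B & A] by rewrite disjoint_sym.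
have [vB|vB] /= := boolP (v \in B).
  have [a aP] := matching_partner dBA (perfect_matchingC match_M) vB.
  apply: (@sum_if_pred1 _ _ _ _ a) => u; rewrite /= -aP setUC.
  case: (eqVneq v u) => [<-|_]; last by rewrite andbF.
  by rewrite (disjointFr dBC vB).
have [vC|vC] /= := boolP (v \in C).
  apply: (@sum_if_pred1 _ _ _ _ v) => u; rewrite andbF orbF /= eq_sym.
  by case: eqVneq => [->|_]; rewrite ?vC ?andbF.
rewrite big1 // => u _; rewrite andbF orbF.
by case: (eqVneq v u) => [<-|_]; rewrite ?(negPf vC) ?andbF.
Qed.

Lemma matching_plan_coupling (c : R) : 0 <= c <= 1 ->
  coupling (fun u => if u \in (A :|: C)%SET then c else 0)
           (fun v => if v \in (B :|: C)%SET then c else 0)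
           (matching_plan c).
Proof.
move=> c01; split=> [u v|u|v].
- by rewrite /matching_plan; case: ifP; rewrite ?lexx ?ler01.
- by rewrite matching_plan_row.
- by rewrite matching_plan_col.
Qed.

(** Only the mass on [A] moves, and it moves along edges of the graph, that is,
    over distance one. *)
Lemma matching_plan_cost (c : R) :
  transport_cost e (matching_plan c) = #|A|%:R * c.
Proof.
rewrite -sumr_const mulr_suml big_mkcond; apply: eq_bigr => u _.
have [uA|uA] := boolP (u \in A); last first.
  rewrite big1 // => v _; rewrite /matching_plan /matching_rel (negPf uA) orbF.
  case: ifP => [/andP[_ /eqP->]|_]; last by rewrite mulr0.
  by rewrite gdist_refl mul0r.
rewrite mul1r.
(* Every pair charged by the row of [u] is an edge, so the row costs its mass. *)
rewrite (_ : \sum_v _ = \sum_v matching_plan c u v).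
  by rewrite matching_plan_row inE uA.
apply: eq_bigr => v _; rewrite /matching_plan /matching_rel (disjointFr dAC uA).
rewrite uA /=; case: ifP => [/andP[vB uvM]|_]; last by rewrite mulr0.
case: match_M => /subsetP /(_ _ uvM) uvE _ _.
rewrite gdist_edge ?mul1r //; apply: edges_adj uvE => //.
by apply: contraTneq vB => <-; rewrite (disjointFr dAB uA).
Qed.

End MatchingPlan.

(** * Wasserstein distance and curvature of the edge *)

Lemma W1_matching (R : realType) (V : finType) (e : rel V) (D : nat) (x y : V)
    (M : {set {set V}}) :
  symmetric e -> irreflexive e -> e x y ->
  perfect_matching e
    (nbh e x :\: ((nbh e x :&: nbh e y) :|: [set y]))%SET
    (nbh e y :\: ((nbh e x :&: nbh e y) :|: [set x]))%SET M ->
  W1 e (mu R e D x) (mu R e D y)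
    = #|nbh e x :\: ((nbh e x :&: nbh e y) :|: [set y])|%SET%:R / D.+1%:R.
Proof.
move=> sym_e irr_e exy.
set A := (X in perfect_matching e X); set B := (X in perfect_matching e A X).
move=> matchM; have eyx : e y x by rewrite sym_e.
pose C := ([set x; y] :|: (nbh e x :&: nbh e y))%SET.
have dAB : [disjoint A & B].
  apply/pred0P => u /=; rewrite !inE.
  by case: (e x u); case: (e y u); rewrite /= ?andbF.
have dAC : [disjoint A & C].
  apply/pred0P => u /=; rewrite !inE; have [->|_] := eqVneq u x.
    by rewrite irr_e /= ?andbF.
  by case: (e x u); case: (e y u); case: (u == y).
have dBC : [disjoint B & C].
  apply/pred0P => u /=; rewrite !inE; have [->|_] := eqVneq u y.
    by rewrite irr_e /= ?andbF.
  by case: (e x u); case: (e y u); case: (u == x).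
pose c : R := D.+1%:R^-1.
have c01 : 0 <= c <= 1 by rewrite invr_ge0 ler0n invf_le1 ?ltr0n // ler1n.
have muxE : mu R e D x = fun u => if u \in (A :|: C)%SET then c else 0.
  apply/funext => u; rewrite /mu !inE; congr (if _ then _ else _).
  have [->|ux] := eqVneq u x; first by rewrite /= orbT.
  have [->|uy] := eqVneq u y; first by rewrite exy /= orbT.
  by case: (e x u); case: (e y u).
have muyE : mu R e D y = fun v => if v \in (B :|: C)%SET then c else 0.
  apply/funext => u; rewrite /mu !inE; congr (if _ then _ else _).
  have [->|uy] := eqVneq u y; first by rewrite /= !orbT.
  have [->|ux] := eqVneq u x; first by rewrite eyx /= orbT.
  by case: (e x u); case: (e y u).
have cpi := matching_plan_coupling dAB dAC dBC matchM c01.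
rewrite muxE muyE (W1_eq_cost (e := e) cpi).
  by rewrite (matching_plan_cost sym_e irr_e dAB dAC matchM).
move=> pi' cpi'; rewrite (matching_plan_cost sym_e irr_e dAB dAC matchM).
have -> : #|A|%:R * c = \sum_(u in A) (if u \in (A :|: C)%SET then c else 0).
  rewrite mulr_natl -sumr_const; apply: eq_bigr => u uA.
  by rewrite in_setU uA.
apply: sum_le_transport_cost cpi' _ => u uA.
by rewrite in_setU (disjointFr dAB uA) (disjointFr dAC uA).
Qed.

Theorem proposition1p1 (R : realType) (V : finType) (e : rel V)
    (D L : nat) (x y : V)
    (simple_e : simple_graph e) (connected_e : connected_graph e)
    (regular_e : regular e D) (diam_e : diameter e = L)
    (exy : e x y)
    (triangles_xy :
       #|[set T in triangles e | [set x; y] \subset T]%SET|%:R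
         = 2 * D%:R / L%:R - 2 :> R)
    (matching_xy : exists M : {set {set V}},
       perfect_matching e
         (nbh e x :\: ((nbh e x :&: nbh e y) :|: [set y]))%SET
         (nbh e y :\: ((nbh e x :&: nbh e y) :|: [set x]))%SET M) :
  kappa R e D x y = 2 / L%:R.
Proof.
case: simple_e => sym_e irr_e; case: matching_xy => M matchM.
rewrite /kappa gdist_edge // divr1 (W1_matching R D sym_e irr_e exy matchM).
move: triangles_xy; rewrite card_triangles_edge //.
set t := #|_| => tE.
have cardA : (#|nbh e x :\: ((nbh e x :&: nbh e y) :|: [set y])|%SET + t.+1
    = D)%N.
  have sub : (nbh e x :&: nbh e y) :|: [set y]%SET \subset nbh e x.
    by rewrite subUset subsetIl sub1set inE.
  rewrite -(regular_e x) -[RHS](cardsID ((nbh e x :&: nbh e y) :|: [set y])%SET).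
  rewrite (setIidPr sub) addnC; congr (_ + _)%N.
  by rewrite setUC cardsU1 !inE irr_e andbF.
have D0 : D%:R != 0 :> R by rewrite pnatr_eq0 -cardA addnS.
have S0 : D.+1%:R != 0 :> R by rewrite pnatr_eq0.
move: cardA; set a := #|_| => cardA.
have aE : D.+1%:R - a%:R = t%:R + 2 :> R.
  by rewrite -cardA -natrD -natrB ?leqW ?leq_addr // -addnS addKn addn2.
rewrite (_ : 1 - _ = (D.+1%:R - a%:R) / D.+1%:R); last first.
  by rewrite mulrBl divff.
by rewrite aE tE subrK [LHS]mulrC mulrA divfK // mulrAC mulfK.
Qed.
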